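(* Let $q\in[0,1)$. Let $\{\tilde T^{\mathrm{qT}}(\mathsf t)\}_{\mathsf t\ge0}$ be the Markov semigroup of the homogeneous continuous-time $q$-TASEP on $\mathscr{X}$, and $\{\tilde B^{\mathrm{qT}}(\tau)\}_{\tau\ge0}$ the Markov semigroup of the backwards $q$-TASEP on $\mathscr{X}$. Then for all $\mathsf t,\tau\in\mathbb{R}_{\ge0}$, $$\tilde T^{\mathrm{qT}}(\mathsf t)\,\tilde B^{\mathrm{qT}}(\tau)=\tilde B^{\mathrm{qT}}(\tau)\,\tilde T^{\mathrm{qT}}(e^{-\tau}\mathsf t),$$ i.e. $\sum_{\mathbf{y}}\tilde T^{\mathrm{qT}}(\mathsf t)(\mathbf{x},\mathbf{y})\tilde B^{\mathrm{qT}}(\tau)(\mathbf{y},\mathbf{z})=\sum_{\mathbf{y}}\tilde B^{\mathrm{qT}}(\tau)(\mathbf{x},\mathbf{y})\tilde T^{\mathrm{qT}}(e^{-\tau}\mathsf t)(\mathbf{y},\mathbf{z})$ for all $\mathbf{x},\mathbf{z}\in\mathscr{X}$. Equivalently, running the $q$-TASEP from $\mathbf{y}$ for time $\mathsf t$ and then the backwards $q$-TASEP for time $\tau$ gives the same distribution as the $q$-TASEP at time $e^{-\tau}\mathsf t$ started from the random configuration obtained by running the backwards $q$-TASEP from $\mathbf{y}$ for time $\tau$.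
   Context: $\mathscr{X}$ is the set of integer sequences $\mathbf{x}=(x_1>x_2>\dots)$ with $x_n=-n$ for all sufficiently large $n$; convention $x_0=+\infty$. $(a;q)_k=\prod_{i=0}^{k-1}(1-aq^i)$. Homogeneous continuous-time $q$-TASEP: each particle $x_n$ has an independent exponential clock of rate $1-q^{x_{n-1}-x_n-1}$ (rate $1$ for $n=1$); when it rings, $x_n$ jumps right by $1$. Backwards $q$-TASEP: each particle $x_n$, $n\ge1$, has an independent exponential clock of rate $n\,g_n$ with $g_n=x_n-x_{n+1}-1$; when it rings, $x_n$ jumps to a new location $x_n'$ with $x_{n+1}<x_n'<x_n$ chosen with probability $\frac{1}{g_n(1-q^{x_n-x_n'})}\frac{(q;q)_{g_n}}{(q;q)_{g_n'}}$, where $g_n'=x_n'-x_{n+1}-1$. *)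

(* Defs.v *)
From HB Require Import structures.
From mathcomp Require Import all_boot all_order all_algebra.
From mathcomp Require Import all_classical all_reals all_analysis.
Set Implicit Arguments. Unset Strict Implicit. Unset Printing Implicit Defensive.
Import Order.TTheory GRing.Theory Num.Theory.
Import numFieldNormedType.Exports.
Local Open Scope classical_set_scope.
Local Open Scope ring_scope.

(* Configurations.  A configuration x = (x_1 > x_2 > ...) is stored as a
   function f : nat -> int with f i = x_{i+1} (0-based storage; particle
   number n = i+1).  The set \mathscr{X}: strictly decreasing and
   x_n = -n for all sufficiently large n. *)
Definition is_config (f : nat -> int) : Prop :=
  (forall i, f i.+1 < f i) /\
  exists N : nat, forall i : nat, (N <= i)%N -> f i = - (i.+1)%:Z.

Record config := Config { cpos :> nat -> int; cposP : is_config cpos }.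

HB.instance Definition _ := gen_eqMixin config.
HB.instance Definition _ := gen_choiceMixin config.

Definition upd (f : nat -> int) (i : nat) (v : int) : nat -> int :=
  fun k => if k == i then v else f k.

Definition qpoch {R : pzRingType} (a q : R) (k : nat) : R :=
  \prod_(j < k) (1 - a * q ^+ j).

Section Rates.
Variables (R : realType) (q : R).

(* q-TASEP: clock rate of particle n = i+1: 1 for n = 1 (x_0 = +oo),
   and 1 - q^{x_{n-1}-x_n-1} otherwise. *)
Definition qtasep_clock (x : config) (i : nat) : R :=
  if i is i'.+1 then 1 - q ^+ absz (x i' - x i - 1)%R else 1.

Definition qtasep_rate (x z : config) : R :=
  fine (\esum_(i in [set i : nat | cpos z = upd x i (x i + 1)])
          (qtasep_clock x i)%:E).

Definition bgap (x : config) (i : nat) : nat := absz (x i - x i.+1 - 1)%R.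

Definition bjump_prob (x : config) (i : nat) (v : int) : R :=
  (bgap x i)%:R^-1 * (1 - q ^+ absz (x i - v)%R)^-1
  * (qpoch q q (bgap x i) / qpoch q q (absz (v - x i.+1 - 1)%R)).

(* total rate from x to z: sum over particles n and admissible new
   locations v producing z of (clock rate n g_n) * (jump probability) *)
Definition bqtasep_rate (x z : config) : R :=
  fine (\esum_(p in [set p : nat * int |
                     (x p.1.+1 < p.2) && (p.2 < x p.1) /\
                     cpos z = upd x p.1 p.2])
          ((p.1.+1)%:R * (bgap x p.1)%:R * bjump_prob x p.1 p.2)%:E).

End Rates.

(* P is the (transition function of the) Markov semigroup generated by the
   jump rates [rate]: a family of stochastic matrices on config, equal to the
   identity at time 0, right-continuous at 0 and solving the Kolmogorov
   backward equation
     d/dt P_t(x,y) = sum_z rate(x,z) P_t(z,y) - (sum_z rate(x,z)) P_t(x,y)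
   for t > 0.  For the two (non-explosive) chains considered here this
   determines P uniquely. *)
Definition markov_semigroup {R : realType} (rate : config -> config -> R)
    (P : R -> config -> config -> R) : Prop :=
  [/\ (forall (t : R) (x y : config), 0 <= t -> 0 <= P t x y),
      (forall (t : R) (x : config), 0 <= t -> (\esum_(y in [set: config]) (P t x y)%:E = 1)%E),
      (forall x y : config, P 0 x y = if `[< x = y >] then 1 else 0),
      (forall x y : config, (fun t : R => P t x y) @ 0^'+ --> P 0 x y) &
      (forall (x y : config) (t : R), 0 < t ->
         is_derive t 1 (fun s => P s x y)
           (fine (\esum_(z in [set: config]) (rate x z * P t z y)%:E)
            - fine (\esum_(z in [set: config]) (rate x z)%:E) * P t x y))].

(* Main.v *)
Require Import Defs.
From HB Require Import structures.
From mathcomp Require Import all_boot all_order all_algebra.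
From mathcomp Require Import all_classical all_reals all_analysis.
From mathcomp Require Import zify ring lra.
Import Order.TTheory GRing.Theory Num.Theory.
Import numFieldNormedType.Exports.
Local Open Scope classical_set_scope.
Local Open Scope ring_scope.

Set Implicit Arguments.
Unset Strict Implicit.
Unset Printing Implicit Defensive.

(** In terms of the gaps, the forward dynamics moves one unit from gap [n-1] to
    gap [n], the backward dynamics moves [k] units from gap [n] to gap [n-1], and
    both are graded by [deg x = \sum_n n g_n]: the forward generator [fgen] raises
    the degree by one, the backward generator [bgen] lowers it.  A computation
    with the rates gives [bgen fgen - fgen bgen = fgen].  Since the backward
    equation is triangular in the degree its solutions are unique, whence
    [fgen B(tau) = e^{-tau} B(tau) fgen].  Thus
    [G t = B(tau) T(e^{-tau} t)(., z)] solves the backward equation of the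
    q-TASEP with initial value [B(tau)(., z)], as do, for the initial value
    truncated at degree [K], the finite sums [F K t] approximating
    [T(t) B(tau)(., z)].  The total q-TASEP rate is at most [deg x + 1], so
    [e^t (deg x + 1)] is a supersolution, and comparing with it gives
    [0 <= G - F K <= e^t (deg x + 1) / (K + 1)]. *)

(** * Configurations, their gaps and the elementary moves *)

Lemma config_inj (x y : config) : cpos x = cpos y -> x = y.
Proof.
case: x y => f fP [g gP] /= fg; subst g.
by congr Config; exact: Prop_irrelevance.
Qed.

(** Strict decrease makes the absolute value in [bgap] harmless; this linear form is the one used in
    calculations. *)
Lemma bgapE (x : config) i : x i = x i.+1 + 1 + (bgap x i)%:Z.
Proof. by have [/(_ i) h _] := cposP x; rewrite /bgap; lia. Qed.

Lemma is_config_ground : is_config (fun i => - (i.+1)%:Z).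
Proof. by split=> [i|]; [lia|exists 0%N]. Qed.

Definition ground := Config is_config_ground.

Definition mkconfig (f : nat -> int) : config :=
  if pselect (is_config f) is left p then Config p else ground.

Lemma mkconfigE f : is_config f -> cpos (mkconfig f) = f.
Proof. by rewrite /mkconfig; case: pselect. Qed.

(* When the target site is not free, [up] and [down] return the junk value
   [ground]; the corresponding rates vanish. *)
Definition up (x : config) i := mkconfig (upd x i (x i + 1)).
Definition down (x : config) i (k : nat) := mkconfig (upd x i (x i - k%:Z)).

(** The gap ahead of particle [i] is stored at index [i - 1]; the first particle is never
    blocked. *)
Definition free (x : config) i := if i is j.+1 then (0 < bgap x j)%N else true.

Lemma is_config_upd (x : config) i v : x i.+1 < v ->
  (if i is j.+1 then v < x j else true) -> is_config (upd x i v).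
Proof.
move=> vl vr; have [xd [N xN]] := cposP x; split=> [j|].
  rewrite /upd; case: eqP => [e|_]; case: eqP => [e'|_] //; subst => //; lia.
exists (maxn N i.+1) => j; rewrite geq_max => /andP[Nj ij].
by rewrite /upd gtn_eqF// xN.
Qed.

Lemma upE x i : free x i -> cpos (up x i) = upd x i (x i + 1).
Proof.
move=> h; rewrite mkconfigE//; apply: is_config_upd.
  by have := bgapE x i; lia.
by case: i h => [|j] //= h; have := bgapE x j; lia.
Qed.

Lemma downE x i k : (k <= bgap x i)%N ->
  cpos (down x i k) = upd x i (x i - k%:Z).
Proof.
move=> h; rewrite mkconfigE//; apply: is_config_upd.
  by have := bgapE x i; lia.
by case: i h => [|j] //= h; have := bgapE x j; lia.
Qed.

Lemma down0 x i : down x i 0 = x.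
Proof.
apply: config_inj; rewrite downE//; apply/funext => j.
by rewrite /upd; case: eqP => [->|]//; rewrite subr0.
Qed.

Lemma bgap_up x i j : free x i -> bgap (up x i) j =
  if j == i then (bgap x i).+1 else if j.+1 == i then (bgap x j).-1
  else bgap x j.
Proof.
move=> h; rewrite {1}/bgap upE// /upd.
case: (eqVneq j i) => [ji|ji]; [subst j|case: (eqVneq j.+1 i) => [e|ne]].
- by have := bgapE x i; rewrite (gtn_eqF (ltnSn i)); lia.
- by subst i; have := bgapE x j; rewrite /= in h; lia.
- by [].
Qed.

Lemma bgap_down x i k j : (k <= bgap x i)%N -> bgap (down x i k) j =
  if j == i then (bgap x i - k)%N else if j.+1 == i then (bgap x j + k)%N
  else bgap x j.
Proof.
move=> h; rewrite {1}/bgap downE// /upd.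
case: (eqVneq j i) => [ji|ji]; [subst j|case: (eqVneq j.+1 i) => [e|ne]].
- by have := bgapE x i; rewrite (gtn_eqF (ltnSn i)); lia.
- by subst i; have := bgapE x j; rewrite /= in h; lia.
- by [].
Qed.

(** * Gaps as coordinates, and the degree *)

Lemma bgap_eventually0 (x : config) :
  exists N, forall i, (N <= i)%N -> bgap x i = 0%N.
Proof.
have [_ [N xN]] := cposP x; exists N => i Ni.
by rewrite /bgap !xN//; lia.
Qed.

(** Both sequences agree far out, and [bgapE] carries the equality from index [i + 1] to index
    [i]. *)
Lemma bgap_inj x y : bgap x =1 bgap y -> x = y.
Proof.
move=> g; apply: config_inj; apply/funext.
have [_ [N xN]] := cposP x; have [_ [M yM]] := cposP y.
move=> i; move: {2}(N + M - i)%N (leqnn (N + M - i)%N) => n.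
elim: n i => [|n IH] i hn; first by rewrite xN ?yM//; lia.
by rewrite (bgapE x) (bgapE y) g IH//; lia.
Qed.

(* The degree is the total displacement from the ground configuration,
   [\sum_n (x_n + n)], written in terms of the gaps. *)
Definition deg (x : config) : nat :=
  \sum_(i < projT1 (cid (bgap_eventually0 x))) i.+1 * bgap x i.

Lemma degE x n : (forall i, (n <= i)%N -> bgap x i = 0%N) ->
  deg x = (\sum_(i < n) i.+1 * bgap x i)%N.
Proof.
move=> hn; rewrite /deg; case: cid => m /= hm.
rewrite -!(big_mkord xpredT (fun i => i.+1 * bgap x i)%N).
wlog: m n hn hm / (m <= n)%N => [W|mn].
  by case/orP: (leq_total m n) => mn; [exact: W|symmetry; exact: W].
rewrite [RHS](big_cat_nat (n:=m))//= [X in (_ + X)%N]big1_seq ?addn0//.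
by move=> i /=; rewrite mem_index_iota => /andP[mi _]; rewrite hm// muln0.
Qed.

Lemma bgap_deg x i : (i.+1 * bgap x i <= deg x)%N.
Proof.
have [N hN] := bgap_eventually0 x.
rewrite (@degE x (N + i.+1)); last by move=> j hj; apply: hN; lia.
have iN : (i < N + i.+1)%N by lia.
by rewrite (bigD1 (Ordinal iN))//= leq_addr.
Qed.

Lemma bgap_eq0 x i : (deg x <= i)%N -> bgap x i = 0%N.
Proof. by have := bgap_deg x i; case: (bgap x i) => // n; lia. Qed.

Lemma degW x n : (deg x <= n)%N -> deg x = (\sum_(i < n) i.+1 * bgap x i)%N.
Proof. by move=> h; apply: degE => i hi; apply: bgap_eq0; lia. Qed.

Lemma sum_delta (n i h : nat) : (i < n)%N ->
  (\sum_(j < n) j.+1 * (h * (j == i :> nat)) = i.+1 * h)%N.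
Proof.
move=> lin; rewrite (bigD1 (Ordinal lin))//= eqxx muln1 big1 ?addn0//.
by move=> j; rewrite -val_eqE /= => /negPf->; rewrite !muln0.
Qed.

(** A unit leaves gap [i - 1], of weight [i], and enters gap [i], of weight [i + 1]; for [i = 0] it
    enters gap [0] from outside. *)
Lemma deg_up x i : free x i -> deg (up x i) = (deg x).+1.
Proof.
move=> h; set n := (deg x + i.+1)%N.
have H1 : forall j, (n <= j)%N -> bgap (up x i) j = 0%N.
  move=> j nj; rewrite bgap_up//; rewrite !ifF; try (apply/negP => /eqP; lia).
  by apply: bgap_eq0; lia.
rewrite (degE H1) (@degW x n); last by rewrite leq_addr.
case: i h @n H1 => [|i'] h n H1.
  have e : (\sum_(j < n) j.+1 * (1 * (j == 0 :> nat)) = 1)%N.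
    by rewrite sum_delta; lia.
  rewrite -addn1 -[X in _ = (_ + X)%N]e.
  rewrite -big_split /=; apply: eq_bigr => j _; rewrite bgap_up//.
  rewrite -mulnDr; congr (_ * _)%N.
  by case: eqP => [->|?] /=; lia.
have e : (\sum_(j < n) j.+1 * bgap (up x i'.+1) j + i'.+1 * 1 =
       \sum_(j < n) j.+1 * bgap x j + i'.+2 * 1)%N.
  rewrite -(@sum_delta n i' 1)%N -?(@sum_delta n i'.+1 1)%N; try lia.
  rewrite -!big_split /=; apply: eq_bigr => j _; rewrite bgap_up// eqSS -!mulnDr.
  congr (_ * _)%N; rewrite /= in h.
  by case: eqP => [->|?]; [|case: eqP => [->|?]]; lia.
by lia.
Qed.

Lemma deg_down x i k : (k <= bgap x i)%N -> (deg (down x i k) + k)%N = deg x.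
Proof.
move=> h; set n := (deg x + i.+1)%N.
have H1 : forall j, (n <= j)%N -> bgap (down x i k) j = 0%N.
  move=> j nj; rewrite bgap_down//.
  rewrite !ifF; try (apply/negP => /eqP; lia).
  by apply: bgap_eq0; lia.
rewrite (degE H1) (@degW x n); last by rewrite leq_addr.
case: i h @n H1 => [|i'] h n H1.
  have n0 : (0 < n)%N by lia.
  rewrite -[X in (_ + X)%N]mul1n -(sum_delta k n0).
  rewrite -big_split /=; apply: eq_bigr => j _; rewrite bgap_down//.
  rewrite -mulnDr; congr (_ * _)%N.
  by case: eqP => [->|?] /=; lia.
have e : (\sum_(j < n) j.+1 * bgap (down x i'.+1 k) j + i'.+2 * k =
       \sum_(j < n) j.+1 * bgap x j + i'.+1 * k)%N.
  rewrite -(@sum_delta n i' k)%N -?(@sum_delta n i'.+1 k)%N; try lia.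
  rewrite -!big_split /=; apply: eq_bigr => j _; rewrite bgap_down// eqSS -!mulnDr.
  congr (_ * _)%N; rewrite /= in h.
  by case: eqP => [->|?]; [|case: eqP => [->|?]]; lia.
by lia.
Qed.

(** Such a configuration is determined by its first [n] gaps, each at most [n], since the later gaps
    vanish. *)
Lemma finite_deg_le n : finite_set [set x | (deg x <= n)%N].
Proof.
pose code x : {ffun 'I_n -> 'I_n.+1} := [ffun i : 'I_n => inord (bgap x i)].
pose ocode x := if (deg x <= n)%N then Some (code x) else None.
have -> : [set x | (deg x <= n)%N] = ocode @^-1` [set c | c != None].
  by apply/seteqP; split=> x /=; rewrite /ocode; case: ifP.
apply: finite_preimage; last by exact: finite_finset.
move=> x y; rewrite !inE /= /ocode; case: ifP => // dx _; case: ifP => // dy _.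
move=> [] /ffunP cxy; apply: bgap_inj => i; have [ni|ni] := leqP n i.
  by rewrite !bgap_eq0//; lia.
have := cxy (Ordinal ni); rewrite !ffunE => /(congr1 val) /=.
by rewrite !inordK//; have := bgap_deg x i; have := bgap_deg y i; lia.
Qed.

(** * Identities for q-Pochhammer symbols and jump weights *)

Section Generators.
Variables (R : realType) (q : R).
Hypotheses (hq0 : 0 <= q) (hq1 : q < 1).
Implicit Types (f g : config -> R) (x y : config).

Local Notation p := (qpoch q q).

Lemma qpochS k : p k.+1 = p k * (1 - q ^+ k.+1).
Proof. by rewrite /qpoch big_ord_recr /= -exprS. Qed.

Lemma subr1_exp_gt0 k : 0 < 1 - q ^+ k.+1.
Proof. by rewrite subr_gt0 exprn_ilt1. Qed.

Lemma qpoch_gt0 k : 0 < p k.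
Proof. by apply: prodr_gt0 => j _; rewrite -exprS subr1_exp_gt0. Qed.

Lemma qpoch_neq0 k : p k != 0.
Proof. by rewrite gt_eqF// qpoch_gt0. Qed.

Lemma subr1_exp_neq0 k : 1 - q ^+ k.+1 != 0.
Proof. by rewrite gt_eqF// subr1_exp_gt0. Qed.

(* Rate, up to the factor [n], of a backward jump of length [k] across a gap of
   size [m]. *)
Definition jumpw (m k : nat) : R :=
  if (k <= m)%N then p m / ((1 - q ^+ k) * p (m - k)) else 0.

Lemma jumpw_ge0 m k : 0 <= jumpw m k.+1.
Proof.
rewrite /jumpw; case: ifP => // _.
by rewrite divr_ge0 ?mulr_ge0 ?ltW ?qpoch_gt0 ?subr1_exp_gt0.
Qed.

(** Finite form of an identity of Euler; it telescopes because [1 / p m.+1 - 1 / p m = q ^+ m.+1 / p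
    m.+1]. *)
Lemma sum_qpochV m : \sum_(k < m.+1) q ^+ k / p k = (p m)^-1.
Proof.
elim: m => [|m IH].
  by rewrite big_ord_recr big_ord0 /= add0r expr0 div1r.
rewrite big_ord_recr IH /= qpochS.
by field; rewrite qpoch_neq0 subr1_exp_neq0.
Qed.

Lemma jumpwS m k : (k <= m)%N ->
  jumpw m.+1 k.+1 = jumpw m k.+1 + q ^+ (m - k) * p m / p (m - k).
Proof.
move=> km; rewrite /jumpw ltnS km subSS qpochS.
case: ltngtP km => // [km _|-> _]; last first.
  by rewrite subnn /qpoch big_ord0 expr0; field; rewrite subr1_exp_neq0.
have -> : (m - k = (m - k.+1).+1)%N by lia.
set n := (m - k.+1)%N; have -> : m.+1 = (k.+1 + n.+1)%N by rewrite /n; lia.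
rewrite qpochS exprD.
by field; rewrite !qpoch_neq0 !subr1_exp_neq0.
Qed.

(** Normalisation of the backward jump distribution: the probabilities across a gap of size [m] sum
    to one. The increment in [m] given by [jumpwS] is summed by [sum_qpochV]. *)
Lemma sum_jumpw m : \sum_(k < m) jumpw m k.+1 = m%:R.
Proof.
elim: m => [|m IH]; first by rewrite big_ord0.
under eq_bigr => k _ do rewrite jumpwS ?[(k <= m)%N]leq_ord//.
rewrite big_split /= big_ord_recr /= {2}/jumpw ltnn addr0 IH.
rewrite -natr1; congr (_ + _).
rewrite (reindex_inj rev_ord_inj) /=.
under eq_bigr => k _.
  rewrite !subSS subKn ?[(k <= m)%N]leq_ord// -mulrA [p m * _]mulrC mulrA.
  over.
by rewrite -mulr_suml sum_qpochV mulVf ?qpoch_neq0.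
Qed.

Lemma jumpw_subr1_exp m k : (k < m)%N ->
  jumpw m k.+1 * (1 - q ^+ k.+1) = p m / p (m - k.+1).
Proof.
by move=> km; rewrite /jumpw km; field; rewrite qpoch_neq0 subr1_exp_neq0.
Qed.

(** Exchanges a backward jump with a forward jump of the next particle behind, whose clock reads the
    same gap. *)
Lemma jumpw_comm m k : (k < m)%N ->
  jumpw m.+1 k.+1 * (1 - q ^+ (m - k)) = (1 - q ^+ m.+1) * jumpw m k.+1.
Proof.
move=> km; rewrite /jumpw ltnS (ltnW km) km subSS qpochS.
have -> : (m - k = (m - k.+1).+1)%N by lia.
rewrite qpochS.
by field; rewrite !qpoch_neq0 !subr1_exp_neq0.
Qed.

(** Compares the two orders of a backward and a forward move of one particle, with [h] standing for
    [qgap x i]. For [k = m] the first weight is the default value [0]. *)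
Lemma jumpw_bracket m k (h : R) : (k <= m)%N ->
  jumpw m k.+1 * (1 - h * q ^+ k.+1) - (1 - h) * jumpw m.+1 k.+1
  = p m / p (m - k) * (h - q ^+ (m - k)).
Proof.
move=> km; rewrite jumpwS// /jumpw.
case: ltngtP km => // [km _|-> _]; last first.
  by rewrite subnn /qpoch big_ord0 expr0; field.
have -> : (m - k = (m - k.+1).+1)%N by lia.
rewrite qpochS.
by field; rewrite !qpoch_neq0 !subr1_exp_neq0.
Qed.

(* [q ^ (x_{n-1} - x_n - 1)], with the convention [x_0 = +oo] *)
Definition qgap x i : R := if i is j.+1 then q ^+ bgap x j else 0.

Lemma qtasep_clockE x i : qtasep_clock q x i = 1 - qgap x i.
Proof. by case: i => [|i] //=; rewrite subr0. Qed.

Lemma qgap_ge0 x i : 0 <= qgap x i.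
Proof. by case: i => //= i; rewrite exprn_ge0. Qed.

Lemma qgap_le1 x i : qgap x i <= 1.
Proof. by case: i => //= i; rewrite exprn_ile1// ltW. Qed.

Lemma qgap_eq1 x i : (deg x < i)%N -> qgap x i = 1.
Proof. by case: i => //= i h; rewrite bgap_eq0. Qed.

Lemma qgap_nfree x i : ~~ free x i -> qgap x i = 1.
Proof. by case: i => //= i; rewrite lt0n negbK => /eqP ->. Qed.

Lemma qgap_down x i k j : (k <= bgap x i)%N -> qgap (down x i k) j =
  if j == i then qgap x i * q ^+ k
  else if j == i.+1 then q ^+ (bgap x i - k) else qgap x j.
Proof.
move=> h; case: j => [|j] /=.
  by case: eqP => // <-; rewrite mul0r.
rewrite bgap_down// eqSS; case: (eqVneq j i) => [->|ji].
  by rewrite gtn_eqF.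
by case: eqP => // <-; rewrite exprD.
Qed.

(** * The two generators and their commutation relation *)

Definition fjump j f x := (1 - qgap x j) * f (up x j).
Definition bjump i f x :=
  \sum_(k < bgap x i) jumpw (bgap x i) k.+1 * f (down x i k.+1).
Definition clocks n x := \sum_(j < n) (1 - qgap x j).

(** Particles with index above [deg x] are blocked, so the sum misses no jump. In [bgen] the loss
    factor is [deg x] because the clock rates [n g_n] add up to the degree. *)
Definition fgen f x := \sum_(j < (deg x).+1) fjump j f x - clocks (deg x).+1 x * f x.
Definition bgen f x := \sum_(i < deg x) i.+1%:R * bjump i f x - (deg x)%:R * f x.

Lemma sum_widen (F : nat -> R) n m : (n <= m)%N ->
  (forall i, (n <= i)%N -> F i = 0) -> \sum_(i < n) F i = \sum_(i < m) F i.
Proof.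
move=> nm F0; rewrite -!(big_mkord xpredT).
rewrite [RHS](big_cat_nat (n:=n))//= [X in _ + X]big1_seq ?addr0//.
by move=> i /=; rewrite mem_index_iota => /andP[ni _]; rewrite F0.
Qed.

Lemma clocksW x n : (deg x <= n)%N -> clocks (deg x).+1 x = clocks n.+1 x.
Proof.
by move=> h; apply: (@sum_widen (fun j => 1 - qgap x j)) => // i ?; rewrite qgap_eq1 ?subrr.
Qed.

Lemma fgenW f x n : (deg x <= n)%N ->
  fgen f x = \sum_(j < n.+1) fjump j f x - clocks n.+1 x * f x.
Proof.
move=> h; rewrite /fgen (clocksW h); congr (_ - _).
apply: (@sum_widen (fun j => fjump j f x)) => // i ?.
by rewrite /fjump qgap_eq1 ?subrr ?mul0r.
Qed.

Lemma bgenW f x n : (deg x <= n)%N ->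
  bgen f x = \sum_(i < n) i.+1%:R * bjump i f x - (deg x)%:R * f x.
Proof.
move=> h; rewrite /bgen; congr (_ - _).
apply: (@sum_widen (fun j => j.+1%:R * bjump j f x)) => // i ?.
by rewrite /bjump bgap_eq0// big_ord0 mulr0.
Qed.

Lemma up_down_comm x i j k : i != j -> free x j -> (k <= bgap x i)%N ->
  free (down x i k) j -> (k <= bgap (up x j) i)%N ->
  up (down x i k) j = down (up x j) i k.
Proof.
move=> ij h1 h2 h3 h4; apply: config_inj; rewrite upE// !downE// upE//.
apply/funext => l; rewrite /upd (negPf ij) [j == i]eq_sym (negPf ij).
by case: (eqVneq l j) => [->|//]; rewrite eq_sym (negPf ij).
Qed.

Lemma up_downS x i k : (k < bgap x i)%N -> up (down x i k.+1) i = down x i k.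
Proof.
move=> h; apply: config_inj; rewrite upE ?downE// ?[(k <= _)%N]ltnW//.
  by apply/funext => l; rewrite /upd eqxx; case: eqP => // _; lia.
by case: i h => //= i h; rewrite bgap_down// eqxx ltn_eqF//; lia.
Qed.

Lemma downS_up x i k : free x i -> (k <= bgap x i)%N ->
  down (up x i) i k.+1 = down x i k.
Proof.
move=> fx h; apply: config_inj; rewrite !downE//; last first.
  by rewrite bgap_up// eqxx.
by rewrite upE//; apply/funext => l; rewrite /upd eqxx; case: eqP => // _; lia.
Qed.

(** Moves of distinct particles interact only for [j = i + 1], where the forward clock reads the gap
    widened or narrowed by the other move; there [jumpw_comm] applies. *)
Lemma bjump_fjump_comm i j f x : i != j -> bjump i (fjump j f) x = fjump j (bjump i f) x.
Proof.
move=> ij; have [fx|nfx] := boolP (free x j); last first.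
  rewrite [RHS]/fjump qgap_nfree// subrr mul0r /bjump big1// => k _.
  rewrite /fjump qgap_down//.
  rewrite [j == i]eq_sym (negPf ij); case: (eqVneq j i.+1) => [e|_].
    by move: nfx; rewrite e /= -leqNgt leqn0 => /eqP e0; case: k; rewrite e0.
  by rewrite qgap_nfree// subrr mul0r mulr0.
rewrite /fjump /bjump bgap_up// (negPf ij) [i.+1 == j]eq_sym mulr_sumr.
case: (eqVneq j i.+1) => [e|ji].
  subst j; case e: (bgap x i) fx => [|m] //= fx; first by rewrite e in fx.
  (* The longest jump closes gap [i] and blocks particle [i + 1], so its term vanishes. *)
  rewrite big_ord_recr /= bgap_down ?e// eqxx subnn expr0 subrr.
  rewrite mul0r mulr0 addr0; apply: eq_bigr => -[k km] _ /=.
  have km' : (k.+1 <= bgap x i)%N by rewrite e ltnS ltnW.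
  rewrite (bgap_down _ km') eqxx e subSS mulrA jumpw_comm// -mulrA.
  rewrite up_down_comm//=; rewrite ?e//.
  - by rewrite bgap_down ?e ?eqxx; lia.
  - by rewrite bgap_up ?e//= eqxx ltn_eqF//= e.
apply: eq_bigr => -[k km] _ /=.
rewrite qgap_down// [j == i]eq_sym (negPf ij) (negPf ji) mulrCA.
congr (_ * (_ * f _)); apply: up_down_comm => //.
- case: j ij ji fx => //= j ij ji fx; rewrite bgap_down//.
  by case: (eqVneq j i) ji => [->|_ _]; rewrite ?eqxx//; case: eqP; lia.
- by rewrite bgap_up// (negPf ij) [i.+1 == j]eq_sym (negPf ji).
Qed.

(** Only the clocks of particles [i] and [i + 1] see the jump. *)
Lemma clocks_down n x i k : (i < n)%N -> (k <= bgap x i)%N ->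
  clocks n.+1 (down x i k) - clocks n.+1 x =
  (qgap x i - q ^+ (bgap x i - k)) * (1 - q ^+ k).
Proof.
move=> ni h; rewrite /clocks -sumrB.
have i1 : (i < n.+1)%N by lia.
have i2 : (i.+1 < n.+1)%N by lia.
rewrite (bigD1 (Ordinal i1))//= (bigD1 (Ordinal i2))/=; last first.
  by rewrite -val_eqE /= gtn_eqF.
rewrite big1 => [|j]; last first.
  rewrite -!val_eqE /= => /andP[ji ji1].
  by rewrite qgap_down// (negPf ji) (negPf ji1) subrr.
rewrite qgap_down// eqxx bgap_down// eqxx.
have e : q ^+ bgap x i = q ^+ (bgap x i - k) * q ^+ k by rewrite -exprD subnK.
by rewrite e; ring.
Qed.

Lemma bjump_fjump_bracket n i f x : (i < n)%N ->
  bjump i (fjump i f) x - fjump i (bjump i f) x - bjump i (fun y => clocks n.+1 y * f y) x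
  + clocks n.+1 x * bjump i f x = (qgap x i - qgap x i.+1) * f x.
Proof.
move=> ni; set m := bgap x i.
have e1 : bjump i (fjump i f) x = \sum_(k < m.+1)
    jumpw m k.+1 * (1 - qgap x i * q ^+ k.+1) * f (down x i k).
  rewrite big_ord_recr /= {2}/jumpw ltnn !mul0r addr0.
  apply: eq_bigr => k _; rewrite /fjump qgap_down// eqxx up_downS// mulrA.
  by [].
have e2 : fjump i (bjump i f) x = \sum_(k < m.+1)
    (1 - qgap x i) * jumpw m.+1 k.+1 * f (down x i k).
  have [fx|nfx] := boolP (free x i); last first.
    by rewrite /fjump qgap_nfree// subrr mul0r big1// => k _; rewrite !mul0r.
  rewrite /fjump /bjump bgap_up// eqxx mulr_sumr; apply: eq_bigr => k _.
  by rewrite downS_up// ?mulrA// leq_ord.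
have e3 : bjump i (fun y => clocks n.+1 y * f y) x - clocks n.+1 x * bjump i f x =
   \sum_(k < m) p m / p (m - k.+1) * (qgap x i - q ^+ (m - k.+1))
      * f (down x i k.+1).
  rewrite /bjump mulr_sumr -sumrB; apply: eq_bigr => k _.
  rewrite -/m -(jumpw_subr1_exp (ltn_ord k)) [X in _ - X]mulrCA -mulrBr -mulrBl.
  by rewrite (clocks_down ni)// -/m; ring.
have reorg (a b c d : R) : a - b - c + d = a - b - (c - d) by ring.
rewrite reorg e3 e1 e2 -sumrB.
(* The summands of [e1 - e2] are those of [e3] with the index shifted by one, so only the term
   [k = 0] survives. *)
under eq_bigr => k _ do rewrite -mulrBl jumpw_bracket ?[(k <= m)%N]leq_ord//.
rewrite big_ord_recl /= addrK subn0 divff ?qpoch_neq0// mul1r down0.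
by [].
Qed.

Lemma sum_by_parts (h : nat -> R) n :
  \sum_(i < n) i.+1%:R * (h i - h i.+1) = \sum_(i < n) h i - n%:R * h n.
Proof.
elim: n => [|n IH]; first by rewrite !big_ord0 mul0r subr0.
by rewrite !big_ord_recr /= IH -natr1; ring.
Qed.

Theorem bgen_fgen_commutator f x : bgen (fgen f) x - fgen (bgen f) x = fgen f x.
Proof.
(* One truncation serves both [x] and the configurations [up x j], of degree [deg x + 1]. *)
pose n := (deg x).+1.
have dn : (deg x <= n)%N by rewrite /n.
have DL i : bjump i (fgen f) x =
    \sum_(j < n.+1) bjump i (fjump j f) x - bjump i (fun y => clocks n.+1 y * f y) x.
  rewrite /bjump exchange_big /= -sumrB; apply: eq_bigr => k _.
  rewrite (@fgenW _ _ n); last by have := deg_down (ltn_ord k); lia.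
  by rewrite mulrBr mulr_sumr.
have UA j : fjump j (bgen f) x =
    \sum_(i < n) i.+1%:R * fjump j (bjump i f) x - n%:R * fjump j f x.
  have [fx|nfx] := boolP (free x j); last first.
    rewrite /fjump qgap_nfree// subrr !mul0r mulr0 subr0 big1// => i _.
    by rewrite mul0r mulr0.
  rewrite /fjump (@bgenW _ _ n) ?deg_up// mulrBr mulr_sumr; congr (_ - _).
    by apply: eq_bigr => i _; rewrite mulrCA.
  by rewrite mulrCA.
rewrite (bgenW _ dn) [fgen (bgen f) x](fgenW _ dn) [bgen f x](bgenW _ dn) [fgen f x](fgenW _ dn).
under eq_bigr => i _ do rewrite DL.
under [X in _ - (X - _)]eq_bigr => j _ do rewrite UA.
rewrite [X in _ - (X - _)]sumrB exchange_big /= -mulr_sumr.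
set SU := \sum_(j < n.+1) fjump j f x.
have key : \sum_(i < n) i.+1%:R *
      (\sum_(j < n.+1) bjump i (fjump j f) x - bjump i (fun y => clocks n.+1 y * f y) x)
    - \sum_(i < n) \sum_(j < n.+1) i.+1%:R * fjump j (bjump i f) x
    + clocks n.+1 x * (\sum_(i < n) i.+1%:R * bjump i f x) = - clocks n.+1 x * f x.
  rewrite mulr_sumr -sumrB -big_split /=.
  transitivity (\sum_(i < n) i.+1%:R * (qgap x i - qgap x i.+1) * f x).
    apply: eq_bigr => i _; rewrite -mulr_sumr mulrCA -mulrBr -mulrDr -mulrA.
    congr (_ * _); rewrite -(bjump_fjump_bracket f x (ltn_ord i)).
    suff e : \sum_(j < n.+1) bjump i (fjump j f) x - \sum_(j < n.+1) fjump j (bjump i f) x =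
        bjump i (fjump i f) x - fjump i (bjump i f) x by rewrite -e; ring.
    have i1 : (i < n.+1)%N by rewrite ltnS ltnW.
    rewrite -sumrB (bigD1 (Ordinal i1))//= big1 ?addr0// => j.
    by rewrite -val_eqE /= => ji; rewrite bjump_fjump_comm ?subrr// eq_sym.
  (* The weights [i + 1] turn the differences of [qgap] into their sum; the boundary value
     [qgap x n] is [1] because [n] exceeds the degree. *)
  rewrite -mulr_suml sum_by_parts; congr (_ * _).
  rewrite /clocks sumrB sumr_const card_ord [in RHS]big_ord_recr qgap_eq1//=.
  by ring.
move: key; rewrite /n -natr1; move: (\sum_(i < _) _) (\sum_(i < _) _) => a b.
move: (\sum_(i < _) _) => c key.
(* The loss factor of [bgen] is larger by one after a forward jump, and this leaves one copy of
   [SU]. *)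
transitivity ((a - b + clocks n.+1 x * c) + SU); last by rewrite key; ring.
by rewrite /n -/SU; ring.
Qed.

End Generators.

(** * Identification of the given jump rates with the generators *)

Section Rates.
Variables (R : realType) (q : R).
Hypotheses (hq0 : 0 <= q) (hq1 : q < 1).

Lemma esum_seq_cond (I : choiceType) (J : seq I) (P : set I) (w : I -> R) :
  uniq J -> (forall i, i \in J -> 0 <= w i) ->
  \esum_(i in [set` J] `&` P) (w i)%:E =
  (\sum_(i <- J) if `[< P i >] then w i else 0)%:E.
Proof.
move=> uJ w0; rewrite esum_mkcondr esum_fset//; last first.
  by move=> i; rewrite inE /= => iJ; case: ifP => //; rewrite lee_fin w0.
rewrite -fsbig_seq// -sumEFin; apply: eq_bigr => i _.
by case: asboolP => h; [rewrite mem_set|rewrite memNset].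
Qed.

Lemma esum_pointmass (w : R) (z0 : config) (g : config -> R) : 0 <= w ->
  (forall z, 0 <= g z) ->
  \esum_(z in [set: config]) ((if `[< z = z0 >] then w else 0) * g z)%:E =
  (w * g z0)%:E.
Proof.
move=> w0 g0; rewrite -(@esum_set1 _ _ z0 (fun z => (w * g z)%:E)); last first.
  by rewrite lee_fin mulr_ge0.
rewrite [RHS]esum_mkcond; apply: eq_esum => z _.
case: asboolP => [->|nz]; first by rewrite mem_set.
by rewrite memNset// mul0r.
Qed.

(** With rates written as sums of point masses, a sum over all target configurations becomes a
    finite sum over jumps. *)
Lemma esum_jumps (I : choiceType) (J : seq I) (tgt : I -> config) (w : I -> R)
    (g : config -> R) :
  (forall i, 0 <= w i) -> (forall z, 0 <= g z) ->
  \esum_(z in [set: config])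
    ((\sum_(i <- J) if `[< z = tgt i >] then w i else 0) * g z)%:E =
  (\sum_(i <- J) w i * g (tgt i))%:E.
Proof.
move=> w0 g0; under eq_esum => z _ do rewrite mulr_suml -sumEFin.
rewrite esum_sum.
  by rewrite -sumEFin; apply: eq_bigr => i _; exact: esum_pointmass.
by move=> z i _ _; rewrite lee_fin mulr_ge0//; case: ifP.
Qed.

Lemma qtasep_rateE x z : qtasep_rate q x z =
  \sum_(i <- iota 0 (deg x).+1)
    if `[< z = up x i >] then 1 - qgap q x i else 0.
Proof.
rewrite /qtasep_rate; set S := [set i | _].
have -> : \esum_(i in S) (qtasep_clock q x i)%:E =
    \esum_(i in [set` iota 0 (deg x).+1] `&` S) (1 - qgap q x i)%:E.
  rewrite esum_mkcond [RHS]esum_mkcond; apply: eq_esum => i _.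
  rewrite qtasep_clockE in_setI.
  have [iJ|iJ] := boolP (i \in iota 0 (deg x).+1).
    by rewrite [X in X && _]mem_set.
  rewrite [in RHS]memNset//=; last exact/negP.
  move: iJ; rewrite mem_iota add0n /= -leqNgt => /(qgap_eq1 q) ->.
  by rewrite subrr; case: ifP.
rewrite esum_seq_cond ?iota_uniq//; last first.
  by move=> i _; rewrite subr_ge0 qgap_le1.
rewrite /=; apply: eq_bigr => i _.
(* For a blocked particle [up x i] is the default value, but both branches are zero. *)
have [fx|nfx] := boolP (free x i); last first.
  by rewrite qgap_nfree// subrr; do 2 case: ifP.
congr (if _ then _ else _); apply: asbool_equiv_eq; split.
  by move=> e; apply: config_inj; rewrite upE.
by move=> e; rewrite /S /= e upE.
Qed.

(** The pair [(i, k)] encodes the jump of particle [i] by [k + 1] sites to the left. *)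
Definition backward_jumps x : seq (nat * nat) :=
  [seq (i, k) | i <- iota 0 (deg x), k <- iota 0 (bgap x i)].

Lemma mem_backward_jumps x p :
  (p \in backward_jumps x) = (p.2 < bgap x p.1)%N.
Proof.
apply/allpairsPdep/idP => [[i [k [+ + ->]]]|].
  by rewrite !mem_iota.
case: p => i k /= h; exists i, k; split=> //; rewrite mem_iota//= add0n.
by rewrite ltnNge; apply/negP => /bgap_eq0; lia.
Qed.

Lemma bqtasep_rateE x z : bqtasep_rate q x z =
  \sum_(p <- backward_jumps x) if `[< z = down x p.1 p.2.+1 >] then
    p.1.+1%:R * jumpw q (bgap x p.1) p.2.+1 else 0.
Proof.
pose v (p : nat * nat) : nat * int := (p.1, x p.1 - p.2.+1%:Z).
have v_inj : injective v by move=> [i k] [j l] [-> ?]; congr (_, _); lia.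
rewrite /bqtasep_rate.
pose w (p : nat * int) :=
  p.1.+1%:R * (bgap x p.1)%:R * bjump_prob q x p.1 p.2.
have wE p : (p.2 < bgap x p.1)%N ->
    w (v p) = p.1.+1%:R * jumpw q (bgap x p.1) p.2.+1.
  move=> h; rewrite /w /v /= /bjump_prob /jumpw h.
  have -> : absz (x p.1 - (x p.1 - p.2.+1%:Z))%R = p.2.+1 by lia.
  have -> : absz (x p.1 - p.2.+1%:Z - x p.1.+1 - 1)%R = (bgap x p.1 - p.2.+1)%N.
    by have := bgapE x p.1; lia.
  (* The factor [g_n] of the clock cancels the one in the jump probability. *)
  have : (bgap x p.1)%:R != 0 :> R by rewrite pnatr_eq0; lia.
  by move=> g0; field; rewrite qpoch_neq0// subr1_exp_neq0.
set S := [set p | _].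
have -> : S = [set` [seq v p | p <- backward_jumps x]] `&`
    [set p | cpos z = upd x p.1 p.2].
  apply/seteqP; split=> [[i u] /= [/andP[h1 h2] h3]|[i u] /= [/mapP[[j k]]]].
    move: h1 h2 h3 => /= h1 h2 h3; split=> //; apply/mapP; exists (i, (absz (x i - u)%R).-1).
      by rewrite mem_backward_jumps /=; have := bgapE x i; lia.
    by rewrite /v /=; congr (_, _); lia.
  rewrite mem_backward_jumps /= => h [-> ->] h3; split=> //=.
  by have := bgapE x j; lia.
rewrite (@esum_seq_cond _ _ _ w) /=; last 2 first.
- rewrite map_inj_uniq//; apply: allpairs_uniq_dep; rewrite ?iota_uniq//.
    by move=> i _; exact: iota_uniq.
  by move=> [i k] [j l] _ _ [-> ->].
- move=> _ /mapP[p + ->]; rewrite mem_backward_jumps => h.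
  by rewrite wE// mulr_ge0// jumpw_ge0.
rewrite big_map big_seq [RHS]big_seq; apply: eq_bigr => p.
rewrite mem_backward_jumps => h; rewrite wE//.
congr (if _ then _ else _); apply: asbool_equiv_eq; split.
  by move=> e; apply: config_inj; rewrite downE.
by move=> e; rewrite /= e downE.
Qed.

(** Rewrites the right-hand side of the backward equation as a finite sum; [fine] loses nothing
    since the extended sums are finite. *)
Lemma qtasep_generator x (g : config -> R) : (forall z, 0 <= g z) ->
  fine (\esum_(z in [set: config]) (qtasep_rate q x z * g z)%:E)
  - fine (\esum_(z in [set: config]) (qtasep_rate q x z)%:E) * g x = fgen q g x.
Proof.
move=> g0.
have E (h : config -> R) : (forall z, 0 <= h z) ->
    \esum_(z in [set: config]) (qtasep_rate q x z * h z)%:E =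
    (\sum_(j < (deg x).+1) fjump q j h x)%:E.
  move=> h0; under eq_esum => z _ do rewrite qtasep_rateE.
  rewrite (@esum_jumps _ _ (up x) (fun i => 1 - qgap q x i))//; last first.
    by move=> i; rewrite subr_ge0 qgap_le1.
  by rewrite -(big_mkord xpredT (fun j => fjump q j h x)) /index_iota subn0.
rewrite E// /fgen; congr (_ - _ * _).
under eq_esum => z _ do rewrite -[qtasep_rate q x z]mulr1.
rewrite (E (fun=> 1))//=; apply: eq_bigr => j _; exact: mulr1.
Qed.

Lemma bqtasep_generator x (g : config -> R) : (forall z, 0 <= g z) ->
  fine (\esum_(z in [set: config]) (bqtasep_rate q x z * g z)%:E)
  - fine (\esum_(z in [set: config]) (bqtasep_rate q x z)%:E) * g x = bgen q g x.
Proof.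
move=> g0.
have E (h : config -> R) : (forall z, 0 <= h z) ->
    \esum_(z in [set: config]) (bqtasep_rate q x z * h z)%:E =
    (\sum_(i < deg x) i.+1%:R * bjump q i h x)%:E.
  move=> h0; under eq_esum => z _ do rewrite bqtasep_rateE.
  rewrite (@esum_jumps _ _ (fun p => down x p.1 p.2.+1)
    (fun p => p.1.+1%:R * jumpw q (bgap x p.1) p.2.+1))//; last first.
    by move=> p; rewrite mulr_ge0// jumpw_ge0.
  rewrite /backward_jumps big_allpairs_dep /=.
  rewrite -(big_mkord xpredT (fun i => i.+1%:R * bjump q i h x)) /index_iota subn0.
  congr _%:E; apply: eq_bigr => i _; rewrite /bjump mulr_sumr.
  rewrite -(big_mkord xpredT (fun k => i.+1%:R * (jumpw q (bgap x i) k.+1 *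
     h (down x i k.+1)))) /index_iota subn0.
  by apply: eq_bigr => k _; rewrite mulrA.
rewrite E// /bgen; congr (_ - _ * _).
(* The constant function [1] yields the total rate, which [sum_jumpw] evaluates to the degree. *)
under eq_esum => z _ do rewrite -[bqtasep_rate q x z]mulr1.
rewrite (E (fun=> 1))//= [X in _ = X%:R](degW (leqnn _)) natr_sum.
apply: eq_bigr => i _; rewrite natrM /bjump; congr (_ * _).
by rewrite -[RHS](sum_jumpw hq0 hq1); apply: eq_bigr => k _; rewrite mulr1.
Qed.

End Rates.

(** * Linear differential equations and inequalities on the half-line *)

Section Evolutions.
Variable R : realType.
Implicit Types (u v du dv : R -> R) (c r t : R).

(** The regularity supplied by [markov_semigroup]: right-continuity at [0] and a derivative at
    positive times, enough for the mean value theorem on [[0, t]]. *)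
Definition evolves u du : Prop :=
  u @ 0^'+ --> u 0 /\ forall t, 0 < t -> is_derive t 1 u (du t).

Lemma evolves_ext u du v dv : u =1 v -> (forall t, 0 < t -> du t = dv t) ->
  evolves u du -> evolves v dv.
Proof.
by move=> /funext <- e [u0 ud]; split=> // t t0; rewrite -e//; exact: ud.
Qed.

Lemma evolves_cst c : evolves (fun=> c) (fun=> 0).
Proof. by split=> [|t _]; [exact: cvg_cst|exact: is_derive_cst]. Qed.

Lemma evolvesD u du v dv : evolves u du -> evolves v dv ->
  evolves (fun t => u t + v t) (fun t => du t + dv t).
Proof.
move=> [u0 ud] [v0 vd]; split; first exact: cvgD.
by move=> t t0; apply: is_deriveD; [exact: ud|exact: vd].
Qed.

Lemma evolvesZ c u du : evolves u du ->
  evolves (fun t => c * u t) (fun t => c * du t).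
Proof.
move=> [u0 ud]; split; first by apply: cvgM => //; exact: cvg_cst.
by move=> t t0; apply: is_deriveZ; exact: ud.
Qed.

Lemma evolvesB u du v dv : evolves u du -> evolves v dv ->
  evolves (fun t => u t - v t) (fun t => du t - dv t).
Proof.
move=> Eu Ev; have := evolvesD Eu (evolvesZ (-1) Ev).
by apply: evolves_ext => [t|t _]; rewrite mulN1r.
Qed.

Lemma evolves_sum (I : eqType) (s : seq I) (u du : I -> R -> R) :
  (forall i, i \in s -> evolves (u i) (du i)) ->
  evolves (fun t => \sum_(i <- s) u i t) (fun t => \sum_(i <- s) du i t).
Proof.
elim: s => [|i s IH] H.
  by apply: evolves_ext (evolves_cst 0) => [t|t _]; rewrite big_nil.
have := evolvesD (H i (mem_head _ _))
  (IH (fun j js => H j (mem_behead (s:=i :: s) js))).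
by apply: evolves_ext => [t|t _]; rewrite big_cons.
Qed.

Lemma is_derive_mull c t : is_derive t (1 : R) ( *%R c) c.
Proof.
have h := @is_deriveZ R R R id c t 1 1 (is_derive_id _ _).
by apply: (is_derive_eq h); rewrite /GRing.scale /= mulr1.
Qed.

Lemma evolves_expR c u du : evolves u du ->
  evolves (fun t => expR (c * t) * u t)
          (fun t => expR (c * t) * (c * u t + du t)).
Proof.
move=> [u0 ud].
have ed t : is_derive t 1 (fun s => expR (c * s)) (c * expR (c * t)).
  have h := @is_derive1_comp _ _ _ _ _ _ (is_derive_expR (c * t)) (is_derive_mull c t).
  by apply: (is_derive_eq h); rewrite mulrC.
split.
  apply: cvgM => //; apply: cvg_at_right_filter.
  have := @ex_derive _ _ _ _ _ _ _ (ed 0).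
  by move=> /derivable1_diffP/differentiable_continuous.
move=> t t0; apply: (is_derive_eq (is_deriveM (ed t) (ud _ t0))).
by rewrite /GRing.scale /=; ring.
Qed.

Lemma evolves_rescale c u du : 0 < c -> evolves u du ->
  evolves (fun t => u (c * t)) (fun t => c * du (c * t)).
Proof.
move=> c0 [/cvgrPdist_lt u0 ud]; split.
  apply/cvgrPdist_lt => e e0; have [d /= d0 Hd] := u0 _ e0.
  exists (d / c) => /=; first exact: divr_gt0.
  move=> t; rewrite /= sub0r normrN => tdc t0; rewrite mulr0; apply: Hd.
    by rewrite /= sub0r normrN normrM gtr0_norm// mulrC -ltr_pdivlMr.
  by rewrite mulr_gt0.
move=> t t0.
have h := @is_derive1_comp _ _ _ _ _ _ (ud _ (mulr_gt0 c0 t0)) (is_derive_mull c t).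
by apply: (is_derive_eq h); rewrite mulrC.
Qed.

(** With the integrating factor [expR (r * t)] the function becomes nonincreasing, by the mean value
    theorem. *)
Lemma evolves_le0 r u du : evolves u du ->
  (forall t, 0 < t -> du t <= - r * u t) -> u 0 <= 0 ->
  forall t, 0 <= t -> u t <= 0.
Proof.
move=> Eu dule u0 t; rewrite le_eqVlt => /predU1P[<-//|t0].
have [w0 wd] := evolves_expR r Eu.
set w := (fun _ => _) in w0 wd.
have wc s : 0 < s -> {for s, continuous w}.
  move=> s0; have wds := wd _ s0; have := @ex_derive _ _ _ _ _ _ _ wds.
  by move=> /derivable1_diffP/differentiable_continuous.
suff : w t <= 0 by rewrite /w pmulr_rle0// expR_gt0.
have wd' s : s \in `]0, t[%R ->
    is_derive s 1 w (expR (r * s) * (r * u s + du s)).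
  by rewrite in_itv /= => /andP[s0 _]; exact: wd.
have wcc : {within `[0, t], continuous w}.
  apply/continuous_within_itvP => //; split=> //.
    by move=> s; rewrite in_itv /= => /andP[s0 _]; exact: wc.
  by apply: cvg_at_left_filter; exact: wc.
have [s /[!in_itv]/= /andP[s0 _] e] := MVT t0 wd' wcc.
have : w t - w 0 <= 0.
  rewrite e subr0 mulr_le0_ge0 ?(ltW t0)// mulr_ge0_le0 ?expR_ge0//.
  by have := dule _ s0; lra.
have : w 0 <= 0 by rewrite /w mulr0 expR0 mul1r.
by lra.
Qed.

Lemma evolves_eq0 r u du : evolves u du ->
  (forall t, 0 < t -> du t = - r * u t) -> u 0 = 0 ->
  forall t, 0 <= t -> u t = 0.
Proof.
move=> Eu e u0 t t0; apply/eqP; rewrite eq_le; apply/andP; split.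
  by apply: (evolves_le0 Eu _ _ t0) => [s s0|]; rewrite ?u0// e.
rewrite -oppr_le0 -mulN1r.
apply: (evolves_le0 (r := r) (evolvesZ (-1) Eu) _ _ t0) => [s s0|].
  by rewrite e//; lra.
by rewrite u0 mulr0.
Qed.

End Evolutions.

(** * Finite sums over configurations of bounded degree *)

Definition confs n : seq config :=
  finmap.enum_fset (fset_set [set x | (deg x <= n)%N]).

Lemma mem_confs n x : (x \in confs n) = (deg x <= n)%N.
Proof.
rewrite [LHS](in_fset_set (finite_deg_le n)).
by apply/idP/idP => [|h]; [rewrite inE|rewrite inE].
Qed.

Lemma confs_uniq n : uniq (confs n).
Proof. exact: finmap.fset_uniq. Qed.

Lemma big_subseq_cond (R : nmodType) (I : eqType) (s1 s2 : seq I) (F : I -> R) :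
  uniq s1 -> uniq s2 -> {subset s1 <= s2} ->
  \sum_(i <- s1) F i = \sum_(i <- s2 | i \in s1) F i.
Proof.
move=> u1 u2 s12; rewrite -[RHS]big_filter; apply: perm_big.
apply: uniq_perm; rewrite ?filter_uniq// => i; rewrite mem_filter.
by case: (boolP (i \in s1)) => //= /s12 ->.
Qed.

Lemma esum_seq (R : realType) (I : choiceType) (s : seq I) (F : I -> R) :
  uniq s -> (forall i, 0 <= F i) -> (forall i, i \notin s -> F i = 0) ->
  \esum_(i in [set: I]) (F i)%:E = (\sum_(i <- s) F i)%:E.
Proof.
move=> us F0 sF; rewrite -sumEFin fsbig_seq// -esum_fset//; last first.
  by move=> i _; rewrite lee_fin.
rewrite [RHS]esum_mkcond; apply: eq_esum => i _.
have [h|h] := boolP (i \in s); first by rewrite mem_set.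
by rewrite memNset ?sF//=; exact/negP.
Qed.

Lemma sum_seq_le_esum (R : realType) (I : choiceType) (s : seq I) (F : I -> R) :
  uniq s -> (forall i, 0 <= F i) ->
  ((\sum_(i <- s) F i)%:E <= \esum_(i in [set: I]) (F i)%:E)%E.
Proof.
move=> us F0; apply: esum_ge; exists [set` s]; first by split.
by rewrite -fsbig_seq// sumEFin.
Qed.

(** * Linearity of the generators and triangularity of [bgen] *)

Section LinearOperators.
Variables (R : realType) (q : R).
Implicit Types (f g : config -> R) (x y z : config).

Lemma bjump_lin i f g (c : R) x :
  bjump q i (fun z => f z * c + g z) x = bjump q i f x * c + bjump q i g x.
Proof.
rewrite /bjump mulr_suml -big_split /=; apply: eq_bigr => k _.
by rewrite mulrDr mulrA.
Qed.

Lemma bgen_lin f g (c : R) x :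
  bgen q (fun z => f z * c + g z) x = bgen q f x * c + bgen q g x.
Proof.
rewrite /bgen; under eq_bigr => i _ do rewrite bjump_lin mulrDr mulrA.
by rewrite big_split /= -mulr_suml; ring.
Qed.

Lemma fgen_lin f g (c : R) x :
  fgen q (fun z => f z * c + g z) x = fgen q f x * c + fgen q g x.
Proof.
rewrite /fgen; under eq_bigr => i _ do rewrite /fjump mulrDr mulrA.
by rewrite big_split /= -mulr_suml; rewrite /fjump; ring.
Qed.

Lemma bgen_zero x : bgen q (fun=> 0) x = 0.
Proof.
rewrite /bgen mulr0 subr0 big1// => i _; rewrite /bjump big1 ?mulr0// => k _.
by rewrite mulr0.
Qed.

Lemma fgen_zero x : fgen q (fun=> 0) x = 0.
Proof. by rewrite /fgen mulr0 subr0 big1// => i _; rewrite /fjump mulr0. Qed.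

Lemma bgen_sum (I : Type) (s : seq I) (F : I -> config -> R) (c : I -> R) x :
  bgen q (fun z => \sum_(y <- s) F y z * c y) x = \sum_(y <- s) bgen q (F y) x * c y.
Proof.
elim: s => [|a s IH]; under [in LHS]eq_fun => z do rewrite ?big_nil ?big_cons.
  by rewrite bgen_zero big_nil.
by rewrite bgen_lin IH big_cons.
Qed.

Lemma fgen_sum (I : Type) (s : seq I) (F : I -> config -> R) (c : I -> R) x :
  fgen q (fun z => \sum_(y <- s) F y z * c y) x = \sum_(y <- s) fgen q (F y) x * c y.
Proof.
elim: s => [|a s IH]; under [in LHS]eq_fun => z do rewrite ?big_nil ?big_cons.
  by rewrite fgen_zero big_nil.
by rewrite fgen_lin IH big_cons.
Qed.

Lemma bjump_ext i f g x : (forall z, (deg z < deg x)%N -> f z = g z) ->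
  bjump q i f x = bjump q i g x.
Proof.
move=> fg; apply: eq_bigr => k _; rewrite fg//.
by have := deg_down (ltn_ord k); lia.
Qed.

Lemma bgen_ext f g x : (forall z, (deg z <= deg x)%N -> f z = g z) ->
  bgen q f x = bgen q g x.
Proof.
move=> fg; rewrite /bgen fg//; congr (_ - _); apply: eq_bigr => i _.
by congr (_ * _); apply: bjump_ext => z /ltnW; exact: fg.
Qed.

Lemma bgen_local f x : (forall z, (deg z < deg x)%N -> f z = 0) ->
  bgen q f x = - (deg x)%:R * f x.
Proof.
move=> f0; rewrite /bgen big1 ?add0r ?mulNr// => i _.
rewrite (@bjump_ext i f (fun=> 0))// /bjump big1 ?mulr0// => k _.
by rewrite mulr0.
Qed.

Lemma evolves_fgen (u du : R -> config -> R) x :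
  (forall y, evolves (u^~ y) (du^~ y)) ->
  evolves (fun t => fgen q (u t) x) (fun t => fgen q (du t) x).
Proof.
move=> Eu; apply: evolvesB; last exact: evolvesZ.
by apply: evolves_sum => j _; exact: evolvesZ.
Qed.

(** Induction on the degree: once [u] vanishes at lower degrees, the equation at [x] reads
    [u' = - (deg x + r) u]. The shift [r] is there for [fgen_Bop], the bound [n] for
    [bqtasep_triangular]. *)
Lemma bgen_evolution_eq0 (r : R) n (u : R -> config -> R) :
  (forall x, (deg x < n)%N ->
    evolves (u^~ x) (fun t => bgen q (u t) x - r * u t x)) ->
  (forall x, (deg x < n)%N -> u 0 x = 0) ->
  forall x t, (deg x < n)%N -> 0 <= t -> u t x = 0.
Proof.
move=> Eu u0 x; move: {2}(deg x) (leqnn (deg x)) => m.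
elim: m x => [|m IH] x xm t xn t0.
all: apply: (@evolves_eq0 _ ((deg x)%:R + r) _ _ (Eu _ xn)) => // [s s0|].
- by rewrite bgen_local; [lra|move=> z; lia].
- by exact: u0.
- rewrite bgen_local; first lra.
  by move=> z zx; apply: IH; [lia|lia|exact: ltW].
- exact: u0.
Qed.

End LinearOperators.

(** * Comparison principle for the forward generator *)

Section Uniqueness.
Variables (R : realType) (q : R).
Hypotheses (hq0 : 0 <= q) (hq1 : q < 1).

Lemma clocks_le n x : clocks q n x <= n%:R.
Proof.
rewrite -[n in leRHS]card_ord -sumr_const; apply: ler_sum => j _.
by rewrite lerBlDr lerDl qgap_ge0.
Qed.

(* Downward induction on the degree: the bound holds at high degree because [u]
   is bounded, and [fgen] only involves configurations of the next degree. *)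
Lemma fgen_evolution_le (M c : R) (u : R -> config -> R) : 0 < c ->
  (forall x, evolves (u^~ x) (fun t => fgen q (u t) x)) ->
  (forall t x, 0 <= t -> u t x <= M) ->
  (forall x, u 0 x <= c * (deg x).+1%:R) ->
  forall t x, 0 <= t -> u t x <= c * expR t * (deg x).+1%:R.
Proof.
move=> c0 Eu uM u0.
have [N MN] : exists N : nat, M <= c * N.+1%:R.
  exists (Num.trunc (`|M| / c)); rewrite mulrC -ler_pdivrMr//.
  apply: (@le_trans _ _ (`|M| / c)); last first.
    by rewrite ltW// truncnS_gt.
  by rewrite ler_pM2r ?invr_gt0// ler_norm.
move=> t x t0; move: {2}(N - deg x)%N (leqnn (N - deg x)%N) => m.
elim: m x t t0 => [|m IH] x t t0 hm.
  apply: (le_trans (uM _ _ t0)); apply: (le_trans MN).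
  rewrite -mulrA ler_pM2l// -[leLHS]mul1r ler_pM// ?ler_nat; last by lia.
  by rewrite -expR0 ler_expR.
have [Nx|xN] := leqP N (deg x); first by apply: IH => //; lia.
pose h : R := (deg x).+1%:R.
pose v s := u s x - c * h * (expR (1 * s) * 1).
have Ev : evolves v (fun s => fgen q (u s) x - c * h * (expR (1 * s) * (1 * 1 + 0))).
  apply: evolvesB => //; apply: evolvesZ; apply: evolves_expR.
  exact: evolves_cst.
suff : v t <= 0 by rewrite /v mul1r mulr1 subr_le0 mulrAC.
(* With [C] the total clock rate, the inequality to check reduces to
   [C c e (h + 1) - c h e <= C c h e], that is, to [C <= h]. *)
apply: (@evolves_le0 _ (clocks q (deg x).+1 x) _ _ Ev) => // [s s0|]; last first.
  by rewrite /v mulr0 expR0 !mulr1 subr_le0; exact: u0.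
rewrite /v /fgen -/h; set e := expR (1 * s).
have e0 : 0 < e by exact: expR_gt0.
have S : \sum_(j < (deg x).+1) fjump q j (u s) x <=
    clocks q (deg x).+1 x * (c * e * (h + 1)).
  rewrite /clocks mulr_suml; apply: ler_sum => j _; rewrite /fjump.
  have [fx|nfx] := boolP (free x j); last first.
    by rewrite qgap_nfree// subrr !mul0r.
  apply: ler_wpM2l; first by rewrite subr_ge0 qgap_le1.
  have := IH (up x j) s (ltW s0); rewrite deg_up// -[in (deg x).+2%:R]natr1 -/h.
  by rewrite /e mul1r; apply; lia.
have Ch : clocks q (deg x).+1 x <= h by exact: clocks_le.
have : 0 <= c * e * (h - clocks q (deg x).+1 x).
  by rewrite mulr_ge0 ?subr_ge0// mulr_ge0// ltW.
move: S; move: (\sum_(j < _) _) (clocks _ _ _) (u s x) => a b d.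
by lra.
Qed.

End Uniqueness.

(** * The backward semigroup as an operator, and its exchange with [fgen] *)

Section Semigroups.
Variables (R : realType) (q : R).
Hypotheses (hq0 : 0 <= q) (hq1 : q < 1).

Lemma markov_sum_le1 (rate : config -> config -> R) P t x (s : seq config) :
  markov_semigroup rate P -> 0 <= t -> uniq s -> \sum_(y <- s) P t x y <= 1.
Proof.
move=> [P0 P1 _ _ _] t0 us; rewrite -lee_fin -(P1 t x t0).
by apply: sum_seq_le_esum => // y; exact: P0.
Qed.

Lemma qtasep_evolves T x y : markov_semigroup (qtasep_rate q) T ->
  evolves (fun t => T t x y) (fun t => fgen q (fun z => T t z y) x).
Proof.
move=> [T0 _ _ Tc Td]; split=> // t t0.
rewrite -(qtasep_generator hq0 hq1); first exact: Td.
by move=> z; apply: T0; exact: ltW.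
Qed.

Lemma bqtasep_evolves B x y : markov_semigroup (bqtasep_rate q) B ->
  evolves (fun t => B t x y) (fun t => bgen q (fun z => B t z y) x).
Proof.
move=> [B0 _ _ Bc Bd]; split=> // t t0.
rewrite -(bqtasep_generator hq0 hq1); first exact: Bd.
by move=> z; apply: B0; exact: ltW.
Qed.

Section Backward.
Variable B : R -> config -> config -> R.
Hypothesis HB : markov_semigroup (bqtasep_rate q) B.

(** As a function of its starting point, [B t] with fixed target [y] solves the backward equation
    and is initially zero below degree [deg y]. *)
Lemma bqtasep_triangular t x y : 0 <= t -> (deg x < deg y)%N -> B t x y = 0.
Proof.
move=> t0 xy; apply: (@bgen_evolution_eq0 _ q 0 (deg y) (fun t z => B t z y)) => //.
  move=> z _; apply: evolves_ext (bqtasep_evolves z y HB) => // s _.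
  by rewrite mul0r subr0.
move=> z zy; have [_ _ -> _ _] := HB.
by case: asboolP zy => // ->; rewrite ltnn.
Qed.

(** Action of [B t] on functions; by triangularity the finite sum omits only zero terms when
    [0 <= t]. *)
Definition Bop t (g : config -> R) x := \sum_(y <- confs (deg x)) B t x y * g y.

Lemma BopW n t g x : 0 <= t -> (deg x <= n)%N ->
  Bop t g x = \sum_(y <- confs n) B t x y * g y.
Proof.
move=> t0 xn.
rewrite /Bop (@big_subseq_cond _ _ _ (confs n)) ?confs_uniq//; last first.
  by move=> y; rewrite !mem_confs => /leq_trans; apply.
rewrite [RHS](bigID (mem (confs (deg x)))) /= [X in _ = _ + X]big1 ?addr0//.
move=> y; rewrite mem_confs -ltnNge => xy.
by rewrite bqtasep_triangular// mul0r.
Qed.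

Lemma Bop0 g x : Bop 0 g x = g x.
Proof.
have [_ _ B0 _ _] := HB; rewrite /Bop.
rewrite (bigD1_seq x) ?confs_uniq ?mem_confs//= B0 asboolT// mul1r.
by rewrite big1 ?addr0// => y /eqP yx; rewrite B0 asboolF ?mul0r// => /esym.
Qed.

Lemma Bop_pointmass t x z : 0 <= t ->
  Bop t (fun y => if `[< y = z >] then 1 else 0) x = B t x z.
Proof.
move=> t0; rewrite (@BopW (deg x + deg z))// ?leq_addr//.
rewrite (bigD1_seq z) ?confs_uniq ?mem_confs ?leq_addl//= asboolT// mulr1.
by rewrite big1 ?addr0// => y /eqP yz; rewrite asboolF// mulr0.
Qed.

Lemma Bop_evolves g x :
  evolves (fun t => Bop t g x) (fun t => bgen q (Bop t g) x).
Proof.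
have E y : y \in confs (deg x) -> evolves (fun t => g y * B t x y)
    (fun t => g y * bgen q (fun z => B t z y) x).
  by move=> _; apply: evolvesZ; exact: bqtasep_evolves.
apply: evolves_ext (evolves_sum E) => [t|t t0].
  by apply: eq_bigr => y _; rewrite mulrC.
rewrite (@bgen_ext _ q _ (fun z => \sum_(y <- confs (deg x)) B t z y * g y)).
  by rewrite (bgen_sum q _ (fun y z => B t z y)); apply: eq_bigr => y _; rewrite mulrC.
by move=> z zx; apply: BopW => //; exact: ltW.
Qed.

(* Both sides solve [du/dt = bgen u - u] with the same initial value [fgen g]. *)
Lemma fgen_Bop t g x : 0 <= t ->
  fgen q (Bop t g) x = expR (- t) * Bop t (fgen q g) x.
Proof.
move=> t0; apply/eqP; rewrite -subr_eq0 -[- t]mulN1r; apply/eqP.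
pose u s y := fgen q (Bop s g) y - expR (-1 * s) * Bop s (fgen q g) y.
apply: (@bgen_evolution_eq0 _ q 1 (deg x).+1 u) => // y _; last first.
  rewrite /u mulr0 expR0 mul1r Bop0 (_ : Bop 0 g = g) ?subrr//.
  by apply/funext => z; rewrite Bop0.
have E := evolvesB (evolves_fgen q y (Bop_evolves g))
  (evolves_expR (-1) (Bop_evolves (fgen q g) y)).
apply: evolves_ext E => // s s0; rewrite /u.
have -> : (fun z => fgen q (Bop s g) z - expR (-1 * s) * Bop s (fgen q g) z) =
    (fun z => Bop s (fgen q g) z * - expR (-1 * s) + fgen q (Bop s g) z).
  by apply/funext => z; ring.
(* The commutator replaces [fgen (bgen (Bop s g))] by [bgen (fgen (Bop s g)) - fgen (Bop s g)],
   which produces the term [- u]. *)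
have := bgen_fgen_commutator hq0 hq1 (Bop s g) y.
by rewrite bgen_lin; move/eqP; rewrite subr_eq => /eqP ->; ring.
Qed.

Lemma Bop_bounds t g x : 0 <= t -> (forall y, 0 <= g y <= 1) ->
  0 <= Bop t g x <= 1.
Proof.
have [B0 _ _ _ _] := HB; move=> t0 g01; apply/andP; split.
  by apply: sumr_ge0 => y _; rewrite mulr_ge0 ?B0//; case/andP: (g01 y).
apply: le_trans (markov_sum_le1 x HB t0 (confs_uniq (deg x))).
by apply: ler_sum => y _; rewrite ler_piMr ?B0//; case/andP: (g01 y).
Qed.

End Backward.
End Semigroups.

(** * The intertwining, by comparing both sides through truncations *)

Theorem theorem5p6 (R : realType) (q : R) (hq0 : 0 <= q) (hq1 : q < 1)
    (T B : R -> config -> config -> R) :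
  markov_semigroup (qtasep_rate q) T ->
  markov_semigroup (bqtasep_rate q) B ->
  forall (t tau : R), 0 <= t -> 0 <= tau ->
  forall x z : config,
    \esum_(y in [set: config]) (T t x y * B tau y z)%:E =
    \esum_(y in [set: config]) (B tau x y * T (expR (- tau) * t) y z)%:E.
Proof.
move=> HT HB t tau t0 tau0 x z.
have [T0 _ Ti _ _] := HT; have [B0 _ _ _ _] := HB.
have P01 (rate : config -> config -> R) P s y w :
    markov_semigroup rate P -> 0 <= s -> 0 <= P s y w <= 1.
  move=> HP s0; have [P0 _ _ _ _] := HP; rewrite P0//=.
  have := @markov_sum_le1 _ _ _ s y [:: w] HP s0 isT.
  by rewrite big_seq1.
set c := expR (- tau); have c0 : 0 < c := expR_gt0 _.
have ct s : 0 <= s -> 0 <= c * s by move=> s0; rewrite mulr_ge0// ltW.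
pose G s y := Bop B tau (fun w => T (c * s) w z) y.
have GE : \esum_(y in [set: config]) (B tau x y * T (c * t) y z)%:E = (G t x)%:E.
  apply: esum_seq; first exact: confs_uniq.
    by move=> y; rewrite mulr_ge0 ?B0 ?T0 ?ct.
  move=> y; rewrite mem_confs -ltnNge => xy.
  by rewrite (bqtasep_triangular hq0 hq1 HB)// mul0r.
have G01 s y : 0 <= s -> 0 <= G s y <= 1.
  by move=> s0; apply: (Bop_bounds HB) => // w; exact: P01 HT (ct _ s0).
have Gev y : evolves (G^~ y) (fun s => fgen q (G s) y).
  have E w : w \in confs (deg y) -> evolves (fun s => B tau y w * T (c * s) w z)
      (fun s => B tau y w * (c * fgen q (fun v => T (c * s) v z) w)).
    move=> _; apply: evolvesZ.
    exact: evolves_rescale c0 (qtasep_evolves hq0 hq1 w z HT).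
  apply: evolves_ext (evolves_sum E) => // s s0.
  (* The factor [c] from rescaling time is the factor [expR (- tau)] of [fgen_Bop]. *)
  rewrite /G (fgen_Bop hq0 hq1 HB)// -/c /Bop mulr_sumr.
  by apply: eq_bigr => w _; rewrite mulrCA.
have G0 y : G 0 y = B tau y z.
  rewrite /G mulr0 -(Bop_pointmass hq0 hq1 HB y z tau0).
  by apply: eq_bigr => w _; rewrite Ti.
(* The forward dynamics reaches unbounded degrees, so the left-hand sum is truncated; each [F K] can
   be differentiated term by term. *)
pose F K s y := \sum_(w <- confs K) T s y w * B tau w z.
have F01 K s y : 0 <= s -> 0 <= F K s y <= 1.
  move=> s0; apply/andP; split.
    by apply: sumr_ge0 => w _; rewrite mulr_ge0 ?T0 ?B0.
  apply: le_trans (markov_sum_le1 y HT s0 (confs_uniq K)).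
  apply: ler_sum => w _; rewrite ler_piMr ?T0//.
  by case/andP: (P01 _ _ tau w z HB tau0).
have Fev K y : evolves (F K ^~ y) (fun s => fgen q (F K s) y).
  have E w : w \in confs K -> evolves (fun s => B tau w z * T s y w)
      (fun s => B tau w z * fgen q (fun v => T s v w) y).
    by move=> _; apply: evolvesZ; exact: (qtasep_evolves hq0 hq1 y w HT).
  apply: evolves_ext (evolves_sum E) => [s|s s0].
    by apply: eq_bigr => w _; rewrite mulrC.
  rewrite (fgen_sum q _ (fun w v => T s v w)).
  by apply: eq_bigr => w _; rewrite mulrC.
have F0 K y : F K 0 y = if (deg y <= K)%N then B tau y z else 0.
  rewrite /F -mem_confs; case: ifP => yK.
    rewrite (bigD1_seq y) ?confs_uniq//= Ti asboolT// mul1r.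
    by rewrite big1 ?addr0// => w /eqP yw; rewrite Ti asboolF ?mul0r// => /esym.
  rewrite big1_seq// => w /= wK; rewrite Ti asboolF ?mul0r// => yw.
  by rewrite yw wK in yK.
have Lsub (u v : R -> config -> R) s y :
    fgen q (u s) y - fgen q (v s) y = fgen q (fun w => u s w - v s w) y.
  have -> : (fun w => u s w - v s w) = (fun w => v s w * -1 + u s w).
    by apply/funext => w; ring.
  by rewrite fgen_lin; ring.
(* Initially [F K - G] is nonpositive; the comparison needs a positive constant, so an arbitrarily
   small one is used. *)
have FG K : F K t x <= G t x.
  apply/ler_addgt0Pr => e e0.
  pose k := expR t * (deg x).+1%:R.
  have k0 : 0 < k by rewrite mulr_gt0 ?expR_gt0.
  have := @fgen_evolution_le _ q hq0 hq1 1 (e / k) (fun s y => F K s y - G s y).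
  move=> /(_ (divr_gt0 e0 k0)) H; rewrite -lerBlDl.
  have -> : e = e / k * expR t * (deg x).+1%:R.
    by rewrite -mulrA -/k divfK// gt_eqF.
  apply: H => // [y|s y s0|y].
  - by apply: evolves_ext (evolvesB (Fev K y) (Gev y)) => // s s0; rewrite Lsub.
  - by have := F01 K s y s0; have := G01 s y s0; lra.
  - rewrite F0 G0; apply: (@le_trans _ _ 0); last first.
      by rewrite mulr_ge0// ltW// divr_gt0.
    by case: ifP => _; rewrite ?subrr// sub0r oppr_le0 B0.
(* Initially [G - F K] vanishes up to degree [K] and is at most [1] beyond, hence at most
   [(deg y + 1) / (K + 1)]. *)
have GF K : G t x <= F K t x + K.+1%:R^-1 * (expR t * (deg x).+1%:R).
  have := @fgen_evolution_le _ q hq0 hq1 1 K.+1%:R^-1 (fun s y => G s y - F K s y).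
  rewrite invr_gt0 ltr0n => /(_ isT) H; rewrite -lerBlDl mulrA.
  apply: H => // [y|s y s0|y].
  - by apply: evolves_ext (evolvesB (Gev y) (Fev K y)) => // s s0; rewrite Lsub.
  - by have := F01 K s y s0; have := G01 s y s0; lra.
  - rewrite F0 G0; case: leqP => yK.
      by rewrite subrr mulr_ge0// invr_ge0.
    rewrite subr0; apply: (@le_trans _ _ 1).
      by case/andP: (P01 _ _ tau y z HB tau0).
    by rewrite mulrC ler_pdivlMr// mul1r ler_nat; lia.
rewrite GE; apply/eqP; rewrite eq_le; apply/andP; split.
  apply: ge_ereal_sup => _ [X [finX _] <-].
  rewrite fsbig_finite// sumEFin lee_fin.
  (* Any finite set of configurations lies in some [confs K], with [K] its largest degree. *)
  set s := finmap.enum_fset _.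
  apply: (le_trans _ (FG (\max_(y <- s) deg y))).
  rewrite (@big_subseq_cond _ _ s (confs (\max_(y <- s) deg y))) ?confs_uniq//.
  - rewrite /F [leRHS](bigID (mem s)) /= lerDl; apply: sumr_ge0 => y _.
    by rewrite mulr_ge0 ?T0 ?B0.
  - exact: finmap.fset_uniq.
  - by move=> y ys; rewrite mem_confs; apply: leq_bigmax_seq.
apply/lee_addgt0Pr => e e0.
pose k := expR t * (deg x).+1%:R.
have k0 : 0 < k by rewrite mulr_gt0 ?expR_gt0.
(* Chosen so that the truncation error [k / (K + 1)] is at most [e]. *)
pose K := Num.trunc (k / e).
have Ke : K.+1%:R^-1 * k <= e.
  by rewrite mulrC ler_pdivrMr// mulrC -ler_pdivrMr// ltW// truncnS_gt.
apply: (@le_trans _ _ (F K t x + e)%:E).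
  by rewrite lee_fin (le_trans (GF K))// lerD2l.
rewrite EFinD leeD2r//; apply: sum_seq_le_esum; first exact: confs_uniq.
by move=> y; rewrite mulr_ge0 ?T0 ?B0.
Qed.
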